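(* The function $$u(\alpha)=\max_{2^{-1/\alpha}\le x\le1}(x+1)\int_x^1\log\Big(\frac{y^\alpha}{1-y^\alpha}\Big)\frac{dy}{(1+y)^2},\qquad\alpha>0,$$ satisfies $$\lim_{\alpha\to\infty}\alpha\,u(\alpha)=\frac{\pi^2}{24},$$ and the function $$v(\alpha)=\int_1^\infty\log\big([1-x^{-\alpha}]^{-1}\big)\,dx,\qquad\alpha>1,$$ satisfies $$\lim_{\alpha\to\infty}\alpha\,v(\alpha)=\frac{\pi^2}{6}.$$
   Context: All notation is standard; the functions $u$ and $v$ are defined in the claim. *)

(* Defs.v *)
From HB Require Import structures.
From mathcomp Require Import all_boot all_order all_algebra.
From mathcomp Require Import all_classical all_reals all_analysis.
Set Implicit Arguments.
Unset Strict Implicit.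
Unset Printing Implicit Defensive.
Import Order.TTheory GRing.Theory Num.Theory.
Import numFieldNormedType.Exports.
Local Open Scope classical_set_scope.
Local Open Scope ring_scope.

Definition is_maximum {R : realType} (A : set R) (m : R) : Prop :=
  A m /\ ubound A m.

(* The integrands below are singular at y = 1 and x = 1. Since 0^-1 = 0 and
   ln 0 = 0, they take the junk value 0 there, on a set of measure zero. *)
Definition u_integrand {R : realType} (alpha y : R) : R :=
  ln (y `^ alpha / (1 - y `^ alpha)) / (1 + y) ^+ 2.

Definition u_objective {R : realType} (alpha x : R) : R :=
  (x + 1) * Rintegral (@lebesgue_measure R) `[x, 1] (u_integrand alpha).

Definition u_domain {R : realType} (alpha : R) : set R :=
  `[2 `^ (- alpha^-1), 1].

Definition u_values {R : realType} (alpha : R) : set R :=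
  [set u_objective alpha x | x in u_domain alpha].

(* sup is the maximum as soon as the latter exists, i.e. as soon as
   is_maximum (u_values alpha) (u alpha). *)
Definition u {R : realType} (alpha : R) : R := sup (u_values alpha).

Definition v_integrand {R : realType} (alpha x : R) : R :=
  ln ((1 - x `^ (- alpha))^-1).

(* Rintegral is the Lebesgue integral only for integrable functions; it is 0
   when the integral is infinite. *)
Definition v {R : realType} (alpha : R) : R :=
  Rintegral (@lebesgue_measure R) `[1, +oo[ (v_integrand alpha).

(* Main.v *)
Require Import Defs.
From HB Require Import structures.
From mathcomp Require Import all_boot all_order all_algebra.
From mathcomp Require Import all_classical all_reals all_analysis.
From mathcomp Require Import measurable_realfun ring lra.
Set Implicit Arguments.
Unset Strict Implicit.
Unset Printing Implicit Defensive.
Import Order.TTheory GRing.Theory Num.Theory.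
Import numFieldNormedType.Exports.
Local Open Scope classical_set_scope.
Local Open Scope ring_scope.

(** The function alpha v(alpha): expanding the logarithm,
    alpha v(alpha) = sum_k alpha / (k (k alpha - 1)), which lies between
    zeta(2) and zeta(2) alpha / (alpha - 1).

    The function alpha u(alpha): replacing dy/(1+y)^2 by dy/y makes the integral
    over [2^(-1/alpha), 1] equal to
    (zeta(2) - Li_2(1/2) - (ln 2)^2 / 2) / alpha = pi^2 / (12 alpha). The ratio
    y/(1+y)^2 of the two weights lies between 2^(-1/alpha) / 4 and 1/4, so the
    limit is 2 * (1/4) * pi^2/12.

    zeta(2) comes from Matsuoka's integrals of x^2 cos(x)^(2n) on [0, pi/2], and
    Li_2(1/2) from Euler's reflection formula applied to partial sums. *)

(** * Derivative rules and the fundamental theorem of calculus *)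

Section pointwise_derivatives.
Context {R : realType}.
Implicit Types (f g : R -> R) (x c a b : R).

(** The rules are stated for functions of the form [fun t => ...], so that unification can select
    them from the shape of an expression. *)
Lemma is_derive_fun_cst c x : is_derive x 1 (fun=> c) 0.
Proof. exact: is_derive_cst. Qed.

Lemma is_derive_fun_id x : is_derive x 1 (fun t => t) 1.
Proof. exact: is_derive_id. Qed.

Lemma is_derive_funN f x a :
  is_derive x 1 f a -> is_derive x 1 (fun t => - f t) (- a).
Proof. by move=> fa; exact: is_deriveN. Qed.

Lemma is_derive_funD f g x a b : is_derive x 1 f a -> is_derive x 1 g b ->
  is_derive x 1 (fun t => f t + g t) (a + b).
Proof. by move=> fa gb; exact: is_deriveD. Qed.

Lemma is_derive_funM f g x a b : is_derive x 1 f a -> is_derive x 1 g b ->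
  is_derive x 1 (fun t => f t * g t) (f x * b + g x * a).
Proof. by move=> fa gb; exact: is_deriveM. Qed.

Lemma is_derive_funX f n x a : is_derive x 1 f a ->
  is_derive x 1 (fun t => f t ^+ n) (n%:R * f x ^+ n.-1 * a).
Proof. by move=> fa; rewrite -exprfctE; exact: is_deriveX. Qed.

Lemma is_derive_funV f x a : f x != 0 -> is_derive x 1 f a ->
  is_derive x 1 (fun t => (f t)^-1) (- (f x) ^- 2 * a).
Proof. by move=> fx0 fa; exact: (is_deriveV fx0 fa). Qed.

Lemma is_derive_fun_ln f x a : 0 < f x -> is_derive x 1 f a ->
  is_derive x 1 (fun t => ln (f t)) ((f x)^-1 * a).
Proof. by move=> fx0 fa; exact: (is_derive1_comp (is_derive1_ln fx0) fa). Qed.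

Lemma is_derive_fun_sum (F : nat -> R -> R) (F' : nat -> R) n x :
  (forall k, is_derive x 1 (F k) (F' k)) ->
  is_derive x 1 (fun t => \sum_(k < n) F k t) (\sum_(k < n) F' k).
Proof.
move=> dF; elim: n => [|n ih].
  by under eq_fun do rewrite big_ord0; rewrite big_ord0; exact: is_derive_fun_cst.
by under eq_fun do rewrite big_ord_recr/=; rewrite big_ord_recr; exact: is_derive_funD.
Qed.

End pointwise_derivatives.

(** Hypotheses are tried first: a derivative that requires a side condition, such as that of [ln] or
    [powR], is put in the context beforehand. [derive_with] leaves the equation between the
    derivative found and the one claimed. *)
Ltac derive_step := first
  [ eassumption | eapply is_derive_fun_cst | eapply is_derive_fun_id
  | eapply is_derive_sin | eapply is_derive_cos
  | eapply is_derive_funN | eapply is_derive_funD | eapply is_derive_funX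
  | eapply is_derive_funM ].
Ltac derive_with := eapply is_derive_eq; [repeat derive_step|].

Lemma is_derive_continuous {R : realType} (F : R -> R) (x d : R) :
  is_derive x 1 F d -> {for x, continuous F}.
Proof. by move=> [dF _]; apply/differentiable_continuous/derivable1_diffP. Qed.

Lemma continuous_subset_segment {R : realType} (f : R -> R) (a b : R) :
  (forall x, a <= x <= b -> {for x, continuous f}) ->
  {within `[a, b], continuous f}.
Proof.
move=> cf; apply: continuous_in_subspaceT => x.
by rewrite inE/= in_itv/=; exact: cf.
Qed.

(** Derivability at the endpoints supplies the one-sided limits that [continuous_FTC2] asks for. *)
Lemma is_derive_FTC2 {R : realType} (f F : R -> R) (a b : R) : a < b ->
  (forall x, a <= x <= b -> is_derive x 1 F (f x)) ->
  (forall x, a <= x <= b -> {for x, continuous f}) ->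
  (\int[lebesgue_measure]_(x in `[a, b]) (f x)%:E = (F b - F a)%:E)%E.
Proof.
move=> ab dF cf; rewrite EFinB; apply: continuous_FTC2 => //.
- exact: continuous_subset_segment.
- split=> [x|  |].
  + by rewrite in_itv/= => /andP[ax xb]; have [|? _] := dF x; rewrite ?ltW.
  + apply: cvg_at_right_filter; apply: is_derive_continuous (dF _ _).
    by rewrite lexx ltW.
  + apply: cvg_at_left_filter; apply: is_derive_continuous (dF _ _).
    by rewrite lexx ltW.
- move=> x; rewrite in_itv/= => /andP[ax xb].
  by rewrite derive1E; have [|_ ->] := dF x; rewrite ?ltW.
Qed.

Ltac derive_continuous := eapply is_derive_continuous; repeat derive_step.

(** * The Basel sum *)

Section basel.
Context {R : realType}.
Implicit Types (n : nat) (x : R).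

Let mu := @lebesgue_measure R.
Local Notation I := (`[(0 : R), pi / 2]%classic).
(** The Wallis integrals, followed by Matsuoka's variant with weight x^2. *)
Let A n : R := \int[mu]_(x in I) (cos x ^+ n.*2).
Let B n : R := \int[mu]_(x in I) (x ^+ 2 * cos x ^+ n.*2).

Let pi2_gt0 : 0 < pi / 2 :> R.
Proof. by rewrite divr_gt0 ?pi_gt0. Qed.

Let integrable_continuous (f : R -> R) : continuous f -> mu.-integrable I (EFin \o f).
Proof.
move=> cf; apply: continuous_compact_integrable; first exact: segment_compact.
exact: continuous_subspaceT.
Qed.

Ltac integrable_cc := apply: integrable_continuous => ?; derive_continuous.

Let dcos n x :
  is_derive x 1 (fun t : R => cos t ^+ n.+1) (- (n.+1)%:R * cos x ^+ n * sin x).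
Proof. by derive_with; rewrite /=; ring. Qed.

(** Stands in for integration by parts: each recurrence below says that the integral of an explicit
    derivative vanishes. *)
Let Rintegral_derive_eq0 (f F : R -> R) : (forall x, is_derive x 1 F (f x)) ->
  continuous f -> F (pi / 2) = F 0 -> \int[mu]_(x in I) (f x) = 0.
Proof.
move=> dF cf FF; rewrite /Rintegral (@is_derive_FTC2 _ f F)//=.
  by rewrite FF subrr.
by move=> x _; exact: cf.
Qed.

Let A_rec n : (2 * n.+1%:R) * A n.+1 = (2 * n.+1%:R - 1) * A n.
Proof.
apply/eqP; rewrite -subr_eq0 /A -!RintegralZl//; [|by integrable_cc..].
rewrite -RintegralB//; last 2 first.
- by integrable_cc.
- by integrable_cc.
apply/eqP; apply: (@Rintegral_derive_eq0 _ (fun x => sin x * cos x ^+ n.*2.+1)).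
- move=> x; have := dcos n.*2 x => dc; derive_with.
  rewrite /= doubleS !exprS.
  have -> : n.*2.+1%:R = 2 * n.+1%:R - 1 :> R.
    by rewrite -[in n.*2.+1%:R]muln2 mulrSr natrM mulrSr; ring.
  have := sin2cos2 x; rewrite expr2 => s2.
  transitivity (cos x * (cos x * cos x ^+ n.*2) -
    (2 * n.+1%:R - 1) * (cos x ^+ n.*2) * (sin x * sin x)).
    by ring.
  by rewrite s2; ring.
- by move=> x; derive_continuous.
- by rewrite cos_pihalf sin0 exprS; ring.
Qed.

(** The primitive collects the boundary terms of two integrations by parts applied to [A n.+1]; in
    its derivative the terms in x sin(x) cos(x)^(2n+1) cancel. *)
Let B_rec n : A n.+1 + 2 * n.+1%:R ^+ 2 * B n.+1 =
  n.+1%:R * (2 * n.+1%:R - 1) * B n.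
Proof.
apply/eqP; rewrite -subr_eq0 /A /B -!RintegralZl//; [|by integrable_cc..].
rewrite -RintegralD//; [|by integrable_cc..].
rewrite -RintegralB//; [|by integrable_cc..].
apply/eqP; apply: (@Rintegral_derive_eq0 _ (fun x => x * cos x ^+ n.*2.+2 +
  n.+1%:R * (x ^+ 2 * (sin x * cos x ^+ n.*2.+1)))).
- move=> x; have := dcos n.*2 x => dc; have := dcos n.*2.+1 x => dc1.
  derive_with.
  rewrite /= doubleS !exprS.
  have -> : n.*2.+1%:R = 2 * n.+1%:R - 1 :> R.
    by rewrite -[in n.*2.+1%:R]muln2 mulrSr natrM mulrSr; ring.
  have -> : n.*2.+2%:R = 2 * n.+1%:R :> R.
    by rewrite -doubleS -muln2 natrM mulrC.
  set N := n.+1%:R; set C := cos x ^+ n.*2.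
  have := sin2cos2 x; rewrite expr2 => s2.
  transitivity (cos x * (cos x * C) + N * x ^+ 2 * (cos x * cos x * C -
    (2 * N - 1) * C * (sin x * sin x))); first by ring.
  by rewrite s2; ring.
- by move=> x; derive_continuous.
- by rewrite cos_pihalf sin0 !exprS; ring.
Qed.

Let A_gt0 n : 0 < A n.
Proof.
elim: n => [|n ih].
  rewrite /A; under eq_Rintegral do rewrite expr0.
  rewrite Rintegral_cst//= lebesgue_measure_itv/= lte_fin pi2_gt0.
  by rewrite mul1r oppr0 addr0.
have : 0 < 2 * n.+1%:R * A n.+1.
  rewrite A_rec mulr_gt0// ?subr_gt0 -?natrM ?ltr1n ?mul2n ?doubleS//.
by rewrite pmulr_rgt0// mulr_gt0.
Qed.

(** The difference sin x - x cos x vanishes at 0 and has the derivative x sin x, which is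
    nonnegative on this range. *)
Let xcos_le_sin x : 0 <= x <= pi / 2 -> x * cos x <= sin x.
Proof.
move=> /andP[x0 xpi]; rewrite -subr_ge0.
move: x0; rewrite le_eqVlt => /predU1P[<-|x0]; first by rewrite sin0 mul0r subrr.
pose F (t : R) := sin t - t * cos t.
have dF (t : R) : is_derive t 1 F (t * sin t).
  by rewrite /F; derive_with; rewrite /=; ring.
have [|c cx] := @MVT R F (fun t => t * sin t) 0 x x0 (fun t _ => dF t).
  by apply: continuous_subspaceT => t; exact: is_derive_continuous (dF t).
rewrite {1 2}/F sin0 mul0r !subr0 => ->.
move: cx; rewrite in_itv/= => /andP[c0 cx].
rewrite !mulr_ge0// ?ltW// sin_gt0_pihalf// c0/=.
exact: lt_le_trans xpi.
Qed.

(** By [xcos_le_sin], x^2 cos(x)^(2n+2) is at most sin(x)^2 cos(x)^(2n), whose integral is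
    [A n - A n.+1]; [A_rec] evaluates this difference. *)
Let B_le n : 0 <= B n.+1 <= A n / (2 * n.+1%:R).
Proof.
apply/andP; split.
  apply: Rintegral_ge0 => x; rewrite /= in_itv/= => /andP[x0 xpi].
  by rewrite mulr_ge0 ?sqr_ge0// -mul2n exprM exprn_ge0 ?sqr_ge0.
have -> : A n / (2 * n.+1%:R) = A n - A n.+1.
  have h : 2 * n.+1%:R != 0 :> R by rewrite mulf_neq0.
  apply: (mulfI h); rewrite mulrBr A_rec; field.
  by [].
rewrite /A -RintegralB//; [|by integrable_cc..].
apply: le_Rintegral => //; first by integrable_cc.
- by integrable_cc.
move=> x; rewrite /= in_itv/= => xI.
have C0 : 0 <= cos x ^+ n.*2 by rewrite -mul2n exprM exprn_ge0 ?sqr_ge0.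
have -> : cos x ^+ n.+1.*2 = cos x ^+ 2 * cos x ^+ n.*2 by rewrite doubleS -exprD.
have -> : cos x ^+ n.*2 - cos x ^+ 2 * cos x ^+ n.*2 =
    sin x ^+ 2 * cos x ^+ n.*2 by rewrite sin2cos2; ring.
rewrite mulrA -exprMn.
rewrite ler_wpM2r// ler_sqr ?nnegrE ?xcos_le_sin//; case/andP: xI => x0 xpi.
  rewrite mulr_ge0 ?cos_ge0_pihalf// xpi andbT.
  by rewrite (le_trans _ x0)// oppr_le0 ltW.
apply: sin_ge0_pi; rewrite x0/=.
by apply: le_trans xpi _; rewrite ler_pdivrMr// ler_peMr ?pi_ge0// ler1n.
Qed.

(* Eliminating [A n] between the two recurrences makes the sum telescope. *)
Let sum_inv_sqr n :
  \sum_(k < n) (k.+1%:R ^+ 2)^-1 = 2 * (B 0 / A 0) - 2 * (B n / A n).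
Proof.
elim: n => [|n ih]; first by rewrite big_ord0 subrr.
rewrite big_ord_recr/= ih.
have := B_rec n; have := A_rec n; have := A_gt0 n; have := A_gt0 n.+1.
move: (A n) (A n.+1) (B n) (B n.+1) (B 0 / A 0) => a a' b b' z a'0 a0 Ar Br.
have N0 : n.+1%:R != 0 :> R by [].
have N1 : 2 * n.+1%:R - 1 != 0 :> R.
  by apply/eqP => h; move: Ar; rewrite h mul0r => /eqP; rewrite !mulf_eq0 (negbTE N0) !gt_eqF.
move: (n.+1%:R) N0 N1 Ar Br => N N0 N1 Ar Br.
(* Solving the recurrences for [A n.+1] and [B n] turns the claim into a rational identity in [A n]
   and [B n.+1]. *)
have a'E : a' = (2 * N - 1) * a / (2 * N).
  by apply: (mulfI (x := 2 * N)); [rewrite mulf_neq0|rewrite Ar; field].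
have bE : b = (a' + 2 * N ^+ 2 * b') / (N * (2 * N - 1)).
  by rewrite Br; field; rewrite N1.
rewrite bE a'E; field.
by rewrite N0 N1 gt_eqF.
Qed.

Let B0A0 : 2 * (B 0 / A 0) = pi ^+ 2 / 6.
Proof.
have -> : A 0 = pi / 2.
  rewrite /A /Rintegral (@is_derive_FTC2 _ _ (fun t : R => t))//=; first by rewrite subr0.
  by move=> x _; derive_continuous.
have -> : B 0 = (pi / 2) ^+ 3 / 3.
  have dF (x : R) : is_derive x 1 (fun t => t ^+ 3 / 3) (x ^+ 2 * cos x ^+ 0.*2).
    by derive_with; rewrite expr0 /=; field.
  rewrite /B /Rintegral (is_derive_FTC2 pi2_gt0 (fun x _ => dF x))/=.
    by rewrite [0 ^+ 3]exprS !mul0r subr0.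
  by move=> x _; derive_continuous.
by move: pi (@pi_gt0 R) => p p0; field; rewrite gt_eqF.
Qed.

Lemma cvg_sum_inv_sqr :
  \sum_(k < n) (k.+1%:R ^+ 2)^-1 @[n --> \oo] --> (pi ^+ 2 / 6 : R).
Proof.
rewrite -B0A0 -[X in _ --> X]subr0.
under eq_fun do rewrite sum_inv_sqr.
apply: cvgB; first exact: cvg_cst.
(* [B_le] bounds [B] at successors only, hence the shift. With [A_rec] it gives [B n.+1 / A n.+1] <=
   1/(2n+1) <= 1/(n+1). *)
rewrite -cvg_shiftS /=.
apply: (@squeeze_cvgr _ _ _ _ (fun=> 0) (fun n => 2 * n.+1%:R^-1)).
- near=> n.
  have /andP[B0 BA] := B_le n.
  apply/andP; split; first by rewrite mulr_ge0// divr_ge0// ltW.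
  rewrite ler_wpM2l// ler_pdivrMr//.
  apply: le_trans BA _.
  have := A_rec n.
  have N1 : 1 <= n.+1%:R :> R by rewrite ler1n.
  have := A_gt0 n; have := A_gt0 n.+1.
  move: (A n) (A n.+1) => a a' a'0 a0 Aa.
  rewrite ler_pdivrMr ?mulr_gt0//.
  have -> : n.+1%:R^-1 * a' * (2 * n.+1%:R) = 2 * a' by field.
  nra.
- exact: cvg_cst.
- rewrite -[X in _ --> X](mulr0 2); apply: cvgM; first exact: cvg_cst.
  exact: cvg_harmonic.
Unshelve. all: by end_near. Qed.

End basel.

Lemma cvg_ler {T : Type} {F : set_system T} {FF : ProperFilter F} {R : realType}
  (f : T -> R) (l c : R) :
  f @ F --> l -> (\forall x \near F, f x <= c) -> l <= c.
Proof.
move=> fl fc; rewrite -(cvg_lim _ fl)//; apply: limr_le => //.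
by apply/cvg_ex; exists l.
Qed.

Lemma cvg_ger {T : Type} {F : set_system T} {FF : ProperFilter F} {R : realType}
  (f : T -> R) (l c : R) :
  f @ F --> l -> (\forall x \near F, c <= f x) -> c <= l.
Proof.
move=> fl fc; rewrite -(cvg_lim _ fl)//; apply: limr_ge => //.
by apply/cvg_ex; exists l.
Qed.

(** * The dilogarithm at 1/2 *)

Section dilogarithm.
Context {R : realType}.
Implicit Types (x d s : R) (n : nat).

(** [log_sum] and [dilog_sum] are the partial sums of -ln(1 - x) and of Li_2(x). *)
Definition log_sum n x : R := \sum_(k < n) x ^+ k.+1 / k.+1%:R.

Definition dilog_sum n x : R := \sum_(k < n) x ^+ k.+1 / k.+1%:R ^+ 2.

Lemma is_derive_log_sum n x :
  is_derive x 1 (log_sum n) (\sum_(k < n) x ^+ k).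
Proof.
apply: (@is_derive_fun_sum _ (fun k t => t ^+ k.+1 / k.+1%:R) (fun k => x ^+ k)) => k.
by derive_with; rewrite /=; field.
Qed.

Lemma is_derive_dilog_sum n x :
  is_derive x 1 (dilog_sum n) (\sum_(k < n) x ^+ k / k.+1%:R).
Proof.
apply: (@is_derive_fun_sum _ (fun k t => t ^+ k.+1 / k.+1%:R ^+ 2)
  (fun k => x ^+ k / k.+1%:R)) => k.
by derive_with; rewrite /=; field.
Qed.

(** The remainder vanishes at 0 and has the derivative t^n / (1 - t). The mean value theorem gives x
    c^n / (1 - c) with 0 < c < x, and this expression increases with c. *)
Lemma log_sum_remainder n x : 0 <= x < 1 ->
  0 <= - ln (1 - x) - log_sum n x <= x ^+ n.+1 / (1 - x).
Proof.
move=> /andP[]; rewrite le_eqVlt => /predU1P[<- _|x0 x1].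
  rewrite subr0 ln1 oppr0 exprS mul0r mul0r /log_sum big1 ?subr0 ?lexx//.
  by move=> k _; rewrite exprS !mul0r.
pose F (t : R) := - ln (1 - t) - log_sum n t.
have dF (t : R) : t < 1 -> is_derive t 1 F (t ^+ n / (1 - t)).
  move=> t1; have t1' : 0 < 1 - t by rewrite subr_gt0.
  have dl := is_derive_log_sum n t.
  have dln : is_derive t 1 (fun s => ln (1 - s)) (- (1 - t)^-1).
    eapply is_derive_eq.
      by apply: (@is_derive_fun_ln _ (fun s => 1 - s) _ _ t1'); repeat derive_step.
    by rewrite /=; ring.
  rewrite /F; derive_with.
  have Sn : (1 - t) * (\sum_(k < n) t ^+ k) = 1 - t ^+ n.
    by rewrite -[RHS]opprB subrX1; ring.
  have t10 : 1 - t != 0 by rewrite gt_eqF.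
  by apply: (mulfI t10); rewrite opprK mulrDr mulrN Sn; field.
have [||c cx] := @MVT R F (fun t => t ^+ n / (1 - t)) 0 x x0.
- by move=> t; rewrite in_itv/= => /andP[_ tx]; apply: dF; apply: lt_trans x1.
- apply: continuous_subset_segment => t /andP[_ tx].
  by apply: is_derive_continuous (dF _ _); apply: le_lt_trans x1.
have -> : F 0 = 0.
  rewrite /F subr0 ln1 oppr0 /log_sum big1 ?subr0 ?lexx//.
  by move=> k _; rewrite exprS !mul0r.
rewrite subr0 => Fx; rewrite -/(F x) Fx.
move: cx; rewrite in_itv/= => /andP[c0 cx].
have c1 : 0 < 1 - c by rewrite subr_gt0; apply: lt_trans x1.
rewrite subr0; apply/andP; split.
  by rewrite mulr_ge0 ?ltW// divr_gt0 ?exprn_gt0.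
rewrite exprS -[leRHS]mulrA [leLHS]mulrC ler_wpM2l//; first exact: ltW.
rewrite ler_pM ?exprn_ge0 ?invr_ge0//; [exact: ltW.. | |].
  by rewrite lerXn2r ?nnegrE// ltW.
by rewrite lef_pV2 ?posrE ?subr_gt0// ?lerD2l ?lerN2 ?ltW// -subr_gt0.
Qed.

Lemma cvg_log_sum x : 0 <= x < 1 -> log_sum n x @[n --> \oo] --> - ln (1 - x).
Proof.
move=> x01; have /andP[x0 x1] := x01.
have x1' : 0 < 1 - x by rewrite subr_gt0.
have : (- ln (1 - x) - log_sum n x) @[n --> \oo] --> (0 : R).
  apply: (@squeeze_cvgr _ _ _ _ (fun=> 0) (fun n => x ^+ n * (x / (1 - x)))).
  - near=> n; have := log_sum_remainder n x01.
    by rewrite exprS [in x ^+ _ * _]mulrCA mulrA.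
  - exact: cvg_cst.
  - rewrite -[X in _ --> X](mul0r (x / (1 - x))).
    by apply: cvgM; [apply: cvg_expr; rewrite ger0_norm|exact: cvg_cst].
move=> h; rewrite -[X in _ --> X]subr0.
under eq_fun do rewrite -[log_sum _ x](subKr (- ln (1 - x))).
by apply: cvgB => //; exact: cvg_cst.
Unshelve. all: by end_near. Qed.

(* Euler's reflection: the limit of [reflection n] is constant on ]0, 1[, with
   value the Basel sum at 0. *)
Let reflection n x : R := dilog_sum n x + dilog_sum n (1 - x) + ln x * ln (1 - x).

(** The derivative is written as a difference of two logarithmic remainders, at 1 - x and at x, to
    which [log_sum_remainder] applies. *)
Let is_derive_reflection n x : 0 < x < 1 ->
  is_derive x 1 (reflection n)
    ((- ln x - log_sum n (1 - x)) / (1 - x) - (- ln (1 - x) - log_sum n x) / x).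
Proof.
move=> /andP[x0 x1]; have x1' : 0 < 1 - x by rewrite subr_gt0.
have dl := is_derive_dilog_sum n x.
have dl' : is_derive x 1 (fun t => dilog_sum n (1 - t))
    (- \sum_(k < n) (1 - x) ^+ k / k.+1%:R).
  have dB : is_derive x 1 (fun t => 1 - t) (-1).
    by derive_with; ring.
  by rewrite -mulrN1; exact: (@is_derive1_comp _ (dilog_sum n) (fun t => 1 - t)
    _ _ _ (is_derive_dilog_sum n (1 - x)) dB).
have dln : is_derive x 1 (fun s => ln (1 - s)) (- (1 - x)^-1).
  eapply is_derive_eq.
    by apply: (@is_derive_fun_ln _ (fun s => 1 - s) _ _ x1'); repeat derive_step.
  by rewrite /=; ring.
have dln' := is_derive1_ln x0.
have sE (y : R) : y != 0 -> \sum_(k < n) y ^+ k / k.+1%:R = log_sum n y / y.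
  move=> y0; rewrite /log_sum mulr_suml; apply: eq_bigr => k _.
  by rewrite exprS mulrAC [y * _]mulrC mulfK.
have x0n : x != 0 by rewrite gt_eqF.
have x1n : 1 - x != 0 by rewrite gt_eqF.
rewrite /reflection; derive_with.
by rewrite !sE//; field; rewrite x0n.
Qed.

(** On [d, 1 - d] each of the two quotients in the derivative lies between 0 and (1 - d)^n / d,
    hence so does the absolute value of their difference; the interval [d, 1/2] has length at most
    1. *)
Let reflection_variation n d : 0 < d < 2^-1 ->
  `|reflection n 2^-1 - reflection n d| <= (1 - d) ^+ n / d.
Proof.
move=> /andP[d0 d2].
have [||c] := @MVT R (reflection n) (fun x => (- ln x - log_sum n (1 - x)) / (1 - x)
   - (- ln (1 - x) - log_sum n x) / x) d 2^-1 d2.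
- move=> x; rewrite in_itv/= => /andP[dx x2]; apply: is_derive_reflection.
  by rewrite (lt_trans d0)//=; lra.
- apply: continuous_subset_segment => x /andP[dx x2].
  apply: is_derive_continuous; apply: is_derive_reflection.
  by rewrite (lt_le_trans d0)//=; lra.
rewrite in_itv/= => /andP[dc c2] ->.
have bound (y : R) : d <= y <= 1 - d ->
    0 <= (- ln (1 - y) - log_sum n y) / y <= (1 - d) ^+ n / d.
  move=> /andP[dy yd].
  have y0 : 0 < y by apply: lt_le_trans dy.
  have y1 : 0 < 1 - y by lra.
  have /(log_sum_remainder n)/andP[r0 r1] : 0 <= y < 1 by lra.
  rewrite divr_ge0//=; last exact: ltW.
  rewrite ler_pdivrMr//; apply: le_trans r1 _.
  rewrite exprS -mulrA [leRHS]mulrC ler_wpM2l//; first exact: ltW.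
  rewrite ler_pM ?exprn_ge0 ?invr_ge0//; [exact: ltW..| |].
    by rewrite lerXn2r ?nnegrE//; lra.
  by rewrite lef_pV2 ?posrE//; lra.
have /bound/andP[b0 b1] : d <= c <= 1 - d by lra.
have /bound : d <= 1 - c <= 1 - d by lra.
rewrite subKr => /andP[b0' b1'].
rewrite normrM; apply: le_trans (_ : (1 - d) ^+ n / d * 1 <= _); last by rewrite mulr1.
rewrite ler_pM//.
  by rewrite ler_norml; lra.
by rewrite ler_norml; lra.
Qed.

Let zeta2 : R := pi ^+ 2 / 6.

Let dilog_sum_ge0 n x : 0 <= x -> 0 <= dilog_sum n x.
Proof. by move=> x0; apply: sumr_ge0 => k _; rewrite divr_ge0// exprn_ge0. Qed.

Let dilog_sum_ndecr x : 0 <= x -> nondecreasing_seq (dilog_sum ^~ x).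
Proof.
move=> x0; apply/nondecreasing_seqP => n.
by rewrite /dilog_sum big_ord_recr/= lerDl divr_ge0// exprn_ge0.
Qed.

Let cvg_dilog_sum1 : dilog_sum n 1 @[n --> \oo] --> zeta2.
Proof.
under eq_fun do (rewrite /dilog_sum; under eq_bigr do rewrite expr1n mul1r).
exact: cvg_sum_inv_sqr.
Qed.

(** Termwise x^(k+1) <= x, so the sum is at most x times its value at 1, which increases to
    [zeta2]. *)
Let dilog_sum_le n x : 0 <= x <= 1 -> dilog_sum n x <= x * zeta2.
Proof.
move=> /andP[x0 x1]; apply: (@le_trans _ _ (x * dilog_sum n 1)).
  rewrite /dilog_sum mulr_sumr ler_sum// => k _.
  rewrite expr1n exprS -mulrA ler_wpM2l// ler_wpM2r ?invr_ge0 ?exprn_ge0//.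
  exact: exprn_ile1.
rewrite ler_wpM2l//.
have /cvg_lim <- // := cvg_dilog_sum1.
apply: nondecreasing_cvgn_le; first exact: dilog_sum_ndecr.
by apply/cvg_ex; exists zeta2; exact: cvg_dilog_sum1.
Qed.

(** Taking the argument to be a square makes the crude bound ln z < z sufficient: -ln(s^2) = 2
    ln(1/s) <= 2/s, while -ln(1 - s^2) <= 2 s^2. *)
Let ln_mul_ln_le s : 0 < s <= 2^-1 -> 0 <= ln (s ^+ 2) * ln (1 - s ^+ 2) <= 4 * s.
Proof.
move=> /andP[s0 s2].
have q0 : 0 < s ^+ 2 by rewrite exprn_gt0.
have q1 : s ^+ 2 <= 2^-1 by rewrite expr2; nra.
have l0 : 0 <= - ln (s ^+ 2) <= 2 / s.
  rewrite oppr_ge0 ln_le0/=; last by lra.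
  rewrite lnXn// -mulNrn -lnV ?posrE// -[leLHS]mulr_natl ler_wpM2l// ltW//.
  by apply: ln_sublinear; rewrite invr_gt0.
have l1 : 0 <= - ln (1 - s ^+ 2) <= 2 * s ^+ 2.
  have q2 : 0 < 1 - s ^+ 2 by lra.
  rewrite oppr_ge0 ln_le0/=; last by lra.
  have qE : (1 - s ^+ 2)^-1 = 1 + s ^+ 2 / (1 - s ^+ 2).
    by field; rewrite gt_eqF.
  rewrite -lnV ?posrE// qE; apply: le_trans (le_ln1Dx _) _.
    by rewrite (@lt_le_trans _ _ 0)// divr_ge0// ltW.
  by rewrite ler_pdivrMr//; nra.
have -> : ln (s ^+ 2) * ln (1 - s ^+ 2) = (- ln (s ^+ 2)) * (- ln (1 - s ^+ 2)).
  by ring.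
case/andP: l0 => l0 l0'; case/andP: l1 => l1 l1'.
rewrite mulr_ge0//=.
have -> : 4 * s = (2 / s) * (2 * s ^+ 2) by field; rewrite gt_eqF.
exact: ler_pM.
Qed.

Lemma cvg_dilog_sum_half :
  dilog_sum n 2^-1 @[n --> \oo] --> (pi ^+ 2 / 12 - ln 2 ^+ 2 / 2 : R).
Proof.
have zeta2_ge0 : 0 <= zeta2 by rewrite /zeta2 divr_ge0// sqr_ge0.
have : cvgn (dilog_sum ^~ 2^-1).
  apply: nondecreasing_is_cvgn; first exact: dilog_sum_ndecr.
  exists (2^-1 * zeta2) => _ [n _ <-]; apply: dilog_sum_le; lra.
move=> /cvg_ex[/= l cl].
suff C : 2 * l + ln 2 ^+ 2 = zeta2.
  rewrite (_ : _ - _ = l) //; move: C; rewrite /zeta2; lra.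
have cr : reflection n 2^-1 @[n --> \oo] --> 2 * l + ln 2 ^+ 2.
  have h : 1 - 2^-1 = 2^-1 :> R by lra.
  under eq_fun do rewrite /reflection h -mulr2n -[X in X + _]mulr_natl -expr2 lnV ?posrE// sqrrN.
  by apply: cvgD; [apply: cvgM => //; exact: cvg_cst|exact: cvg_cst].
(* By [reflection_variation] the limit at 1/2 is also the limit at every d in ]0, 1/2[; letting d
   tend to 0 identifies it with [zeta2]. *)
have crd d : 0 < d < 2^-1 -> reflection n d @[n --> \oo] --> 2 * l + ln 2 ^+ 2.
  move=> d02; have h : (1 - d) ^+ n / d @[n --> \oo] --> 0.
    rewrite -[X in _ --> X](mul0r d^-1); apply: cvgM; last exact: cvg_cst.
    by apply: cvg_expr; rewrite ger0_norm; lra.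
  have h0 : reflection n 2^-1 - reflection n d @[n --> \oo] --> 0.
    apply: norm_cvg0; apply: (@squeeze_cvgr _ _ _ _ (fun=> 0) _ _ _ _ _ h).
      by near=> n; rewrite normr_ge0/=; exact: reflection_variation.
    exact: cvg_cst.
  rewrite -[X in _ --> X]subr0.
  rewrite (_ : reflection^~ d = fun n =>
    reflection n 2^-1 - (reflection n 2^-1 - reflection n d)); first exact: cvgB.
  by apply/funext => n; rewrite subKr.
apply/eqP; rewrite eq_le; apply/andP; split.
  apply/ler_addgt0Pr => e e0.
  (* Upper bound, at the point d = s^2: the two dilogarithm sums add up to at most [zeta2], and the
     product of logarithms is at most 4 s <= e. The cap 1/3 keeps s^2 below 1/2. *)
  pose s := Num.min 3^-1 (e / (zeta2 + 4)).
  have z4 : 0 < zeta2 + 4 by lra.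
  have s0 : 0 < s by rewrite lt_min invr_gt0 divr_gt0//= ltr0n.
  have s2 : s <= 3^-1 by rewrite ge_min lexx.
  have se : s * (zeta2 + 4) <= e by rewrite -ler_pdivlMr// ge_min lexx orbT.
  have s4 : s ^+ 2 <= s by rewrite expr2; nra.
  have q0 : 0 < s ^+ 2 by rewrite exprn_gt0.
  have /crd crs : 0 < s ^+ 2 < 2^-1 by lra.
  apply: (cvg_ler crs); near=> n.
  have s01 : 0 < s <= 2^-1 by lra.
  have /andP[_ lnle] := ln_mul_ln_le s01.
  have d1 : dilog_sum n (s ^+ 2) <= s ^+ 2 * zeta2 by apply: dilog_sum_le; lra.
  have d2 : dilog_sum n (1 - s ^+ 2) <= (1 - s ^+ 2) * zeta2.
    by apply: dilog_sum_le; lra.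
  rewrite /reflection; nra.
(* Lower bound: for fixed N, [dilog_sum N 1] is the limit of [dilog_sum N (1 - d)] as d decreases to
   0. For n >= N the latter is at most [reflection n d], whose other terms are nonnegative. *)
apply: (cvg_ler cvg_dilog_sum1); near=> N.
have dN : continuous (dilog_sum N).
  by move=> x; exact: is_derive_continuous (is_derive_dilog_sum N x).
have cN : dilog_sum N (1 - d) @[d --> 0^'+] --> dilog_sum N 1.
  apply: cvg_at_right_filter.
  rewrite -[X in _ --> dilog_sum N X]subr0.
  apply: (@continuous_comp _ _ _ (fun d : R => 1 - d) (dilog_sum N) 0).
    by derive_continuous.
  exact: dN.
apply: (cvg_ler cN); near=> d.
have d02 : 0 < d < 2^-1.
  by apply/andP; split; near: d; [exact: nbhs_right_gt|exact: nbhs_right_lt].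
have /andP[d0 d2] := d02.
apply: (cvg_ger (crd _ d02)); near=> n.
have dnN : dilog_sum N (1 - d) <= dilog_sum n (1 - d).
  by apply: dilog_sum_ndecr; [lra|near: n; exact: nbhs_infty_ge].
have dn0 : 0 <= dilog_sum n d by apply: dilog_sum_ge0; lra.
have ln0 : 0 <= ln d * ln (1 - d) by apply: mulr_le0; apply: ln_le0; lra.
by rewrite /reflection; lra.
Unshelve. all: by end_near. Qed.

End dilogarithm.

(** * Logarithmic integrals as series, and the function v *)

Section integral_series.
Context {R : realType}.
Let mu := @lebesgue_measure R.
Implicit Types (a x y : R).

(** Valid for x <= 0 too, where both logarithms take the default value 0. *)
Lemma lnV_total x : ln x^-1 = - ln x.
Proof.
have [x0|x0] := ltP 0 x; first by rewrite lnV.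
by rewrite !ln0 ?oppr0// invr_le0.
Qed.

Lemma nneseries_EFin (F : nat -> R) (l : R) :
  \sum_(k < n) F k @[n --> \oo] --> l -> (\sum_(k <oo) (F k)%:E = l%:E)%E.
Proof.
move=> Fl; under eq_fun do rewrite sumEFin big_mkord.
rewrite (@EFin_lim _ (fun n => \sum_(k < n) F k)); last by apply/cvg_ex; exists l.
by rewrite (cvg_lim _ Fl).
Qed.

(** Monotone convergence applied to the series of -ln(1 - h). The weight g is 1 for [v] and 1/y for
    [u]. *)
Lemma integral_Nln1B (D : set R) (h g : R -> R) : measurable D ->
  measurable_fun D h -> measurable_fun D g ->
  (forall x, D x -> 0 <= h x < 1) -> (forall x, D x -> 0 <= g x) ->
  (\int[mu]_(x in D) (- ln (1 - h x) * g x)%:E =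
   \sum_(k <oo) \int[mu]_(x in D) (h x ^+ k.+1 / k.+1%:R * g x)%:E)%E.
Proof.
move=> mD mh mg h01 g0.
rewrite -integral_nneseries//.
- apply: eq_integral => x /set_mem Dx; apply/esym/nneseries_EFin.
  rewrite [X in X @ _ --> _](_ : _ = fun n => log_sum n (h x) * g x).
    by apply: cvgM; [exact: cvg_log_sum (h01 _ Dx)|exact: cvg_cst].
  by apply/funext => n; rewrite /log_sum mulr_suml.
- move=> k; apply/measurable_EFinP; apply: measurable_funM => //.
  apply: measurable_funM; last exact: measurable_cst.
  exact: measurable_funX.
- move=> k x Dx; have /andP[h0 _] := h01 _ Dx.
  by rewrite lee_fin mulr_ge0 ?g0// divr_ge0// exprn_ge0.
Qed.

Lemma cvgy_powRN a : 0 < a -> x `^ (- a) @[x --> +oo] --> (0 : R).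
Proof.
move=> a0; apply/cvgrPdist_le => e e0; near=> x.
rewrite sub0r normrN ger0_norm ?powR_ge0//.
(* From e^(-1/a) on, x^(-a) is at most e. *)
have x0 : 0 < e `^ (- a^-1) by rewrite powR_gt0.
have ex : e `^ (- a^-1) <= x by near: x; apply: nbhs_pinfty_ge; rewrite num_real.
have e'E : e = (e `^ (- a^-1)) `^ (- a).
  by rewrite -powRrM mulrNN mulVf ?gt_eqF// powRr1// ltW.
rewrite [leRHS]e'E; move: (e `^ _) x0 ex => y x0 ex.
rewrite !powRN lef_pV2 ?posrE ?powR_gt0// ?(lt_le_trans x0 ex)//.
by apply: ge0_ler_powR; rewrite ?nnegrE// ltW// (lt_le_trans x0).
Unshelve. all: by end_near. Qed.

Lemma continuous_powR a x : 0 < x -> {for x, continuous (fun t => t `^ a)}.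
Proof. by move=> x0; exact: is_derive_continuous (@is_derive1_powR _ a x x0). Qed.

Lemma integral_powRN a : 1 < a ->
  (\int[mu]_(x in `]1%R, +oo[) (x `^ (- a))%:E = ((a - 1)^-1)%:E)%E.
Proof.
move=> a1.
rewrite (@integral_itv_obnd_cbnd _ 1 +oo%O (fun x => (x `^ (- a))%:E)); last first.
  by apply/measurable_EFinP; apply: measurable_funTS; exact: measurable_powR.
have dF (x : R) : 0 < x -> is_derive x 1 (fun x => (1 - a)^-1 * x `^ (1 - a)) (x `^ (- a)).
  move=> x0; have dp := @is_derive1_powR _ (1 - a) x x0.
  derive_with; rewrite mulr0 addr0 mulrA mulVf ?mul1r; last by rewrite subr_eq0 lt_eqF.
  by congr (_ `^ _); ring.
rewrite (@ge0_continuous_FTC2y _ _ (fun x => (1 - a)^-1 * x `^ (1 - a)) 1 0).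
- rewrite powR1 mulr1 sub0e -EFinN; congr EFin; rewrite -invrN; congr (_^-1); ring.
- by move=> x _; exact: powR_ge0.
- apply/continuous_within_itvcyP; split.
    by move=> x; rewrite in_itv/= andbT => x1; apply: continuous_powR; apply: lt_trans x1.
  by apply: cvg_at_right_filter; exact: continuous_powR.
- rewrite -[X in _ --> X](mulr0 ((1 - a)^-1)); apply: cvgM; first exact: cvg_cst.
  by rewrite -opprB; apply: cvgy_powRN; rewrite subr_gt0.
- by move=> x x1; have [] := dF x (lt_trans ltr01 x1).
- by apply: cvg_at_right_filter; exact: is_derive_continuous (dF 1 ltr01).
- move=> x; rewrite in_itv/= andbT => x1; rewrite derive1E.
  by have [_ ->] := dF x (lt_trans ltr01 x1).
Qed.

Lemma v_integrandE a x : v_integrand a x = - ln (1 - x `^ (- a)).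
Proof. by rewrite /v_integrand lnV_total. Qed.

Lemma measurable_v_integrand a (D : set R) : measurable D -> measurable_fun D (v_integrand a).
Proof.
move=> mD; apply: measurable_funTS.
rewrite (_ : v_integrand a = fun x => - ln (1 - x `^ (- a))); last first.
  by apply/funext => x; rewrite v_integrandE.
apply: measurable_funN; apply: measurableT_comp; first exact: measurable_ln.
by apply: measurable_funB; [exact: measurable_cst|exact: measurable_powR].
Qed.

Lemma integral_v_integrand a : 1 < a ->
  (\int[mu]_(x in `[1%R, +oo[) (v_integrand a x)%:E =
   \sum_(k <oo) ((k.+1%:R * (k.+1%:R * a - 1))^-1)%:E)%E.
Proof.
(* The endpoint 1 is dropped because x^(-a) = 1 there, outside the range of the logarithmic
   series. *)
move=> a1; rewrite -integral_itv_obnd_cbnd; last first.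
  by apply/measurable_EFinP; exact: measurable_v_integrand.
have -> : (\int[mu]_(x in `]1%R, +oo[) (v_integrand a x)%:E =
    \int[mu]_(x in `]1%R, +oo[) (- ln (1 - x `^ (- a)) * 1)%:E)%E.
  by apply: eq_integral => x _; rewrite mulr1 v_integrandE.
rewrite integral_Nln1B//; last 2 first.
- by apply: measurable_funTS; exact: measurable_powR.
- move=> x; rewrite /= in_itv/= andbT => x1; rewrite powR_ge0/= powRN.
  have x0 : 0 < x by apply: lt_trans x1.
  rewrite invf_lt1 ?powR_gt0//.
  have : 1 `^ a < x `^ a; last by rewrite powR1.
  by apply: gt0_ltr_powR; rewrite ?nnegrE ?(lt_trans _ a1)// ltW.
apply: eq_eseriesr => k _.
have ka : 1 < k.+1%:R * a.
  by rewrite (lt_le_trans a1)// ler_peMl ?ler1n// ltW// (lt_trans _ a1).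
transitivity (\int[mu]_(x in `]1%R, +oo[) ((k.+1%:R^-1)%:E * (x `^ (- (k.+1%:R * a)))%:E))%E.
  apply: eq_integral => x _; rewrite -EFinM mulr1 mulrC; congr (_ * _)%:E.
  by rewrite -powR_mulrn ?powR_ge0// -powRrM; congr (_ `^ _); ring.
rewrite ge0_integralZl//.
- by rewrite integral_powRN// -EFinM invfM.
- by apply/measurable_EFinP; apply: measurable_funTS; exact: measurable_powR.
- by move=> x _; rewrite lee_fin powR_ge0.
Qed.

(** Termwise comparison: for k >= 1, k a - 1 lies between k (a - 1) and k a. The bounds are on the
    extended integral, so that integrability can be deduced from them. *)
Lemma integral_v_integrand_bounds a : 1 < a ->
  ((pi ^+ 2 / 6 / a)%:E <= \int[mu]_(x in `[1%R, +oo[) (v_integrand a x)%:E <=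
   (pi ^+ 2 / 6 / (a - 1))%:E)%E.
Proof.
move=> a1; rewrite integral_v_integrand//.
have a0 : 0 < a by apply: lt_trans a1.
have cvgZ (c : R) : \sum_(k < n) ((k.+1%:R ^+ 2)^-1 / c) @[n --> \oo] --> pi ^+ 2 / 6 / c.
  under eq_fun do rewrite -mulr_suml.
  by apply: cvgM; [exact: cvg_sum_inv_sqr|exact: cvg_cst].
pose F (c : R) (k : nat) : R := (k.+1%:R ^+ 2)^-1 / c.
rewrite -(@nneseries_EFin (F a) _ (cvgZ a)).
rewrite -(@nneseries_EFin (F (a - 1)) _ (cvgZ (a - 1))) /F.
have k0 (k : nat) : 1 <= k.+1%:R :> R by rewrite ler1n.
have ka (k : nat) : 0 < k.+1%:R * a - 1 by have := k0 k; nra.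
apply/andP; split; apply: lee_nneseries => k _.
- by move=> _; rewrite lee_fin divr_ge0// ltW.
- rewrite lee_fin -invfM lef_pV2 ?posrE ?mulr_gt0 ?exprn_gt0//.
  by rewrite expr2 -mulrA ler_pM2l// lerBlDr lerDl.
- by move=> _; rewrite lee_fin invr_ge0 mulr_ge0// ltW.
- rewrite lee_fin -invfM lef_pV2 ?posrE ?mulr_gt0 ?exprn_gt0// ?subr_gt0//.
  rewrite expr2 -mulrA ler_pM2l//; have := k0 k; nra.
Qed.

Lemma integrable_v_integrand a : 1 < a ->
  mu.-integrable `[1, +oo[ (EFin \o v_integrand a).
Proof.
move=> a1; apply/integrableP; split.
  by apply/measurable_EFinP; exact: measurable_v_integrand.
have /andP[_ h] := integral_v_integrand_bounds a1.
rewrite (le_lt_trans _ (ltry (pi ^+ 2 / 6 / (a - 1))))//.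
apply: le_trans h; rewrite le_eqVlt; apply/orP; left; apply/eqP.
apply: eq_integral => x _ /=; rewrite ger0_norm// v_integrandE oppr_ge0 ln_le0//.
by rewrite gerBl powR_ge0.
Qed.

Lemma cvg_v : a * v a @[a --> +oo] --> (pi ^+ 2 / 6 : R).
Proof.
(* The upper bound has the factor a / (a - 1) = 1 + 1/(a - 1), with the inverse written as a power
   so that [cvgy_powRN] applies. *)
apply: (@squeeze_cvgr _ _ _ _ (fun=> pi ^+ 2 / 6)
  (fun a => pi ^+ 2 / 6 * (1 + (a - 1) `^ (- 1)))).
- near=> a.
  have a1 : 1 < a by near: a; apply: nbhs_pinfty_gt; rewrite num_real.
  have a0 : 0 < a by apply: lt_trans a1.
  have a10 : 0 < a - 1 by rewrite subr_gt0.
  have := integral_v_integrand_bounds a1.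
  have -> : (\int[mu]_(x in `[1%R, +oo[) (v_integrand a x)%:E = (v a)%:E)%E.
    rewrite /v /Rintegral fineK//.
    by apply: integrable_fin_num => //; exact: integrable_v_integrand.
  rewrite !lee_fin ler_pdivrMr// ler_pdivlMr// => /andP[va0 va1].
  rewrite [a * v a]mulrC va0/= powR_inv1; last exact: ltW.
  rewrite -(ler_pM2r a10); have := va1.
  have -> : pi ^+ 2 / 6 * (1 + (a - 1)^-1) * (a - 1) = pi ^+ 2 / 6 * a.
    by field; rewrite gt_eqF.
  by nra.
- exact: cvg_cst.
- rewrite [X in _ --> X](_ : _ = pi ^+ 2 / 6 * (1 + 0)); last by rewrite addr0 mulr1.
  apply: cvgM; first exact: cvg_cst.
  apply: cvgD; first exact: cvg_cst.
  exact: (@cvg_comp _ _ _ (fun a => a - 1) (fun b => b `^ (- 1)) _ _ _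
    (cvg_addrr (- 1)) (cvgy_powRN ltr01)).
Unshelve. all: by end_near. Qed.

End integral_series.

(** * The function u *)

Section maximum.
Context {R : realType}.
Let mu := @lebesgue_measure R.
Implicit Types (a x y : R).

Lemma Rintegral_itvcc_tail (f : R -> R) p q x : p <= x <= q ->
  mu.-integrable `[p, q] (EFin \o f) ->
  \int[mu]_(y in `[x, q]) f y =
  \int[mu]_(y in `[p, q]) f y - \int[mu]_(y in `[p, x]) f y.
Proof.
move=> /andP[px xq] fi.
rewrite (@Rintegral_itvB _ f (BLeft p) (BRight q) x)//.
rewrite Rintegral_itv_obnd_cbnd//.
by apply: integrableS fi => //; apply: subset_itvr; rewrite bnd_simp.
Qed.

(** The tail is the full integral minus the integral up to x, which is continuous in its upper
    limit. *)
Lemma within_continuous_Rintegral_tail (f : R -> R) p q : p <= q ->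
  mu.-integrable `[p, q] (EFin \o f) ->
  {within `[p, q], continuous (fun x => \int[mu]_(y in `[x, q]) f y)}.
Proof.
move=> pq fi.
apply: (@subspace_eq_continuous _ _ _ (fun x =>
  \int[mu]_(y in `[p, q]) f y - \int[mu]_(y in `[p, x]) f y)).
  move=> x; rewrite /from_subspace inE/= in_itv/= => pxq.
  by rewrite [RHS](Rintegral_itvcc_tail pxq).
move=> x; apply: cvgB; first exact: cvg_cst.
exact: (parameterized_integral_continuous pq fi).
Qed.

(* The left end of [u_domain a], where [y `^ a = 1/2]. *)
Let x0 a : R := 2 `^ (- a^-1).

Let x0_gt0 a : 0 < x0 a. Proof. exact: powR_gt0. Qed.

Let x0_lt1 a : 0 < a -> x0 a < 1.
Proof.
move=> a0; rewrite /x0 powRN invf_lt1 ?powR_gt0// -[X in X < _](powRr0 2).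
by rewrite /powR !gt_eqF// ltr_expR mul0r mulr_gt0 ?invr_gt0 ?ln_gt0// ltr1n.
Qed.

Let x0_powR a : 0 < a -> x0 a `^ a = 2^-1.
Proof. by move=> a0; rewrite /x0 -powRrM mulNr mulVf ?gt_eqF// powR_inv1. Qed.

Let powR_bounds a y : 0 < a -> x0 a <= y < 1 -> 2^-1 <= y `^ a < 1.
Proof.
move=> a0 /andP[xy y1].
have y0 : 0 < y by apply: lt_le_trans xy.
apply/andP; split.
  by rewrite -(x0_powR a0); apply: ge0_ler_powR; rewrite ?nnegrE// ltW.
have : y `^ a < 1 `^ a; last by rewrite powR1.
by apply: gt0_ltr_powR; rewrite ?nnegrE// ltW.
Qed.

(* The integrand of [u] with the weight [(1 + y)^-2] replaced by [y^-1]; its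
   integral over the domain is exactly [pi ^+ 2 / 12 / a]. *)
Let log_density a y : R := (a * ln y - ln (1 - y `^ a)) / y.

Let u_integrandE a y : 0 < a -> x0 a <= y <= 1 ->
  u_integrand a y = log_density a y * (y / (1 + y) ^+ 2).
Proof.
move=> a0 /andP[xy y1].
have y0 : 0 < y by apply: lt_le_trans xy.
have -> : u_integrand a y = (a * ln y - ln (1 - y `^ a)) / (1 + y) ^+ 2.
  rewrite /u_integrand; congr (_ / _).
  (* At y = 1 both sides are 0 by the default values 0^-1 = 0 and ln 0 = 0. *)
  move: y1; rewrite le_eqVlt => /predU1P[->|y1].
    by rewrite powR1 subrr invr0 mulr0 ln1 mulr0 ln0// subr0.
  have /(powR_bounds a0)/andP[t0 t1] : x0 a <= y < 1 by rewrite xy.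
  by rewrite ln_div ?posrE ?subr_gt0 ?powR_gt0// ln_powR.
rewrite /log_density mulrA divfK//; exact: lt0r_neq0.
Qed.

(** On the domain y^a >= 1/2, that is, 1 - y^a <= y^a. *)
Let log_density_ge0 a y : 0 < a -> x0 a <= y <= 1 -> 0 <= log_density a y.
Proof.
move=> a0 /andP[xy y1].
have y0 : 0 < y by apply: lt_le_trans xy.
rewrite /log_density divr_ge0//; last exact: ltW.
move: y1; rewrite le_eqVlt => /predU1P[->|y1].
  by rewrite powR1 subrr ln1 mulr0 ln0// subr0.
have /(powR_bounds a0)/andP[t0 t1] : x0 a <= y < 1 by rewrite xy.
by rewrite -ln_powR subr_ge0 ler_ln ?posrE; lra.
Qed.

(** The upper bound is (1 - y)^2 >= 0; the lower one combines y >= [x0 a] with (1 + y)^2 <= 4. *)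
Let weight_bounds a y : 0 < a -> x0 a <= y <= 1 ->
  x0 a / 4 <= y / (1 + y) ^+ 2 <= 4^-1.
Proof.
move=> a0 /andP[xy y1]; have := x0_gt0 a => x00.
have y0 : 0 < y by apply: lt_le_trans xy.
have q0 : 0 < (1 + y) ^+ 2 by rewrite exprn_gt0// addr_gt0.
rewrite ler_pdivlMr// ler_pdivrMr//.
have : (1 + y) ^+ 2 = 1 + 2 * y + y * y by ring.
move=> ->; apply/andP; split; last by nra.
have : 1 + 2 * y + y * y <= 4 by nra.
by nra.
Qed.

Let measurable_inv (p q : R) : 0 < p -> measurable_fun `[p, q] (fun y : R => y^-1).
Proof.
move=> p0; apply: subspace_continuous_measurable_fun => //.
apply: continuous_subset_segment => y /andP[py _].
have y0 : y != 0 by rewrite gt_eqF// (lt_le_trans p0).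
exact: is_derive_continuous (is_derive_funV y0 (is_derive_fun_id y)).
Qed.

Let measurable_powR_on a (D : set R) : measurable_fun D (fun y : R => y `^ a).
Proof. by apply: measurable_funTS; exact: measurable_powR. Qed.

Let measurable_Nln1B a (D : set R) : measurable D -> measurable_fun D (fun y : R => - ln (1 - y `^ a)).
Proof.
move=> mD; apply: measurable_funN; apply: measurableT_comp; first exact: measurable_ln.
by apply: measurable_funB; [exact: measurable_cst|exact: measurable_powR_on].
Qed.

(** For k >= 1 the k-th term has the primitive y^(ka) / (k^2 a); since y^a runs from 1/2 to 1, it
    contributes (1 - 2^(-k)) / (k^2 a). The sum is (zeta(2) - Li_2(1/2)) / a. *)
Let integral_Nln1B_powR a : 0 < a ->
  (\int[mu]_(y in `[x0 a, 1%R]) (- ln (1 - y `^ a) * y^-1)%:E =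
   ((pi ^+ 2 / 12 + ln 2 ^+ 2 / 2) / a)%:E)%E.
Proof.
move=> a0.
have mcc : measurable_fun `[x0 a, 1] (fun y => - ln (1 - y `^ a) * y^-1).
  by apply: measurable_funM; [exact: measurable_Nln1B|exact: measurable_inv].
(* The series requires y^a < 1, so the endpoint 1 is removed; it is restored for each term, where
   the fundamental theorem is applied. *)
rewrite -integral_itv_bndo_bndc; last first.
  by apply/measurable_EFinP; apply: (measurable_funS _ _ mcc) => //; exact: subset_itv_co_cc.
rewrite integral_Nln1B//; last 3 first.
- by apply: (measurable_funS _ _ (@measurable_inv (x0 a) 1 (x0_gt0 a))) => //; exact: subset_itv_co_cc.
- move=> y; rewrite /= in_itv/= => /(powR_bounds a0)/andP[t0 ->].
  by rewrite powR_ge0.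
- move=> y; rewrite /= in_itv/= => /andP[xy _].
  by rewrite invr_ge0 ltW// (lt_le_trans (x0_gt0 a)).
transitivity (\sum_(k <oo) (((k.+1%:R ^+ 2)^-1 - 2^-1 ^+ k.+1 / k.+1%:R ^+ 2) / a)%:E)%E.
  apply: eq_eseriesr => k _.
  pose F (y : R) := (k.+1%:R ^+ 2 * a)^-1 * (y `^ a) ^+ k.+1.
  pose f (y : R) := (y `^ a) ^+ k.+1 / k.+1%:R * y^-1.
  have dF (y : R) : 0 < y -> is_derive y 1 F (f y).
    move=> y0; have dp := @is_derive1_powR _ a y y0.
    rewrite /F /f; derive_with; rewrite mulr0 addr0 powRB; last by rewrite (gt_eqF y0) implybT.
    rewrite (powRr1 (ltW y0)) /= [(y `^ a) ^+ k.+1]exprS.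
    have : k.+1%:R != 0 :> R by [].
    move: (y `^ a) (y `^ a ^+ k) (k.+1%:R : R) => t tk N N0.
    by field; rewrite N0 !gt_eqF.
  rewrite integral_itv_bndo_bndc; last first.
    apply/measurable_EFinP; apply: measurable_funM.
      apply: measurable_funM; last exact: measurable_cst.
      by apply: measurable_funX; exact: measurable_powR_on.
    by apply: (measurable_funS _ _ (@measurable_inv (x0 a) 1 (x0_gt0 a))) => //; exact: subset_itv_co_cc.
  have dFI y : x0 a <= y <= 1 -> is_derive y 1 F (f y).
    by move=> /andP[xy _]; exact: dF (lt_le_trans (x0_gt0 a) xy).
  rewrite (is_derive_FTC2 (x0_lt1 a0) dFI) => [|y /andP[xy _]].
    rewrite /F powR1 expr1n x0_powR//.
    by congr EFin; rewrite invfM; ring.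
  have y0 : 0 < y by apply: lt_le_trans xy.
  have dp := @is_derive1_powR _ a y y0.
  have dV := is_derive_funV (lt0r_neq0 y0) (is_derive_fun_id y).
  by rewrite /f; derive_continuous.
apply: nneseries_EFin.
under eq_fun do rewrite -mulr_suml sumrB -/(dilog_sum _ _).
apply: cvgM; last exact: cvg_cst.
rewrite [X in _ --> X](_ : _ = pi ^+ 2 / 6 - (pi ^+ 2 / 12 - ln 2 ^+ 2 / 2)); last by lra.
by apply: cvgB; [exact: cvg_sum_inv_sqr|exact: cvg_dilog_sum_half].
Qed.

(** The primitive is a (ln y)^2 / 2, and ln y = -(ln 2) / a at the left end. *)
Let integral_ln_div a : 0 < a ->
  (\int[mu]_(y in `[x0 a, 1%R]) (a * ln y * y^-1)%:E = (- (ln 2 ^+ 2 / 2 / a))%:E)%E.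
Proof.
move=> a0.
have y0 y : x0 a <= y <= 1 -> 0 < y by move=> /andP[xy _]; apply: lt_le_trans xy.
pose F y : R := a * (ln y ^+ 2 / 2); pose f y : R := a * ln y * y^-1.
have dF y : x0 a <= y <= 1 -> is_derive y 1 F (f y).
  move=> /y0 yp; have dl := is_derive1_ln yp.
  by rewrite /F /f; derive_with; rewrite /= expr1; field; rewrite gt_eqF.
rewrite (is_derive_FTC2 (x0_lt1 a0) dF) => [|y /y0 yp].
  by rewrite /F ln1 /x0 ln_powR; congr EFin; field; rewrite gt_eqF.
have dl := is_derive1_ln yp.
have dV := is_derive_funV (lt0r_neq0 yp) (is_derive_fun_id y).
by rewrite /f; derive_continuous.
Qed.

(** The density is a continuous function plus a nonnegative one with finite integral. The terms in
    (ln 2)^2 of the two integrals cancel. *)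
Let integrable_log_density a : 0 < a ->
  mu.-integrable `[x0 a, 1] (EFin \o log_density a) /\
  \int[mu]_(y in `[x0 a, 1]) log_density a y = pi ^+ 2 / 12 / a.
Proof.
move=> a0.
have y0 y : x0 a <= y <= 1 -> 0 < y by move=> /andP[xy _]; apply: lt_le_trans xy.
pose f y : R := a * ln y * y^-1; pose g y := - ln (1 - y `^ a) * y^-1.
have fE : log_density a = fun y => f y + g y.
  by apply/funext => y; rewrite /log_density mulrDl.
have fi : mu.-integrable `[x0 a, 1] (EFin \o f).
  apply: continuous_compact_integrable; first exact: segment_compact.
  apply: continuous_subset_segment => y /y0 yp.
  have dl := is_derive1_ln yp.
  have dV := is_derive_funV (lt0r_neq0 yp) (is_derive_fun_id y).
  by rewrite /f; derive_continuous.
have gi : mu.-integrable `[x0 a, 1] (EFin \o g).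
  apply/integrableP; split.
    by apply/measurable_EFinP; apply: measurable_funM; [exact: measurable_Nln1B|exact: measurable_inv].
  rewrite (_ : \int[mu]_(y in _) _ = ((pi ^+ 2 / 12 + ln 2 ^+ 2 / 2) / a)%:E)%E ?ltry//.
  rewrite -(integral_Nln1B_powR a0); apply: eq_integral => y.
  rewrite inE/= in_itv/= => /y0 yp; rewrite ger0_norm// /g mulr_ge0//.
    by rewrite oppr_ge0 ln_le0// gerBl powR_ge0.
  by rewrite invr_ge0 ltW.
split.
  by rewrite fE; exact: (integrableD _ fi gi).
rewrite fE RintegralD// /Rintegral integral_ln_div// integral_Nln1B_powR//=.
by field; rewrite gt_eqF.
Qed.

(** Domination by [log_density], since the ratio of the weights is at most 1/4. *)
Let integrable_u_integrand a : 0 < a ->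
  mu.-integrable `[x0 a, 1] (EFin \o u_integrand a).
Proof.
move=> a0; have [Hi _] := integrable_log_density a0.
have uE : {in `[x0 a, 1]%classic, (fun y => log_density a y * (y / (1 + y) ^+ 2)) =1
    u_integrand a}.
  by move=> y; rewrite inE/= in_itv/= => /(u_integrandE a0).
apply: (le_integrable _ _ _ Hi) => //.
  apply/measurable_EFinP; apply: (eq_measurable_fun _ uE).
  apply: measurable_funM; first by apply/measurable_EFinP; case/integrableP: Hi.
  apply: subspace_continuous_measurable_fun => //.
  apply: continuous_subset_segment => y /andP[xy _].
  have q0 : (1 + y) ^+ 2 != 0.
    by rewrite gt_eqF// exprn_gt0// addr_gt0// (lt_le_trans (x0_gt0 a)).
  have dq : is_derive y 1 (fun t => (1 + t) ^+ 2) (2 * (1 + y)).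
    by derive_with; rewrite /=; ring.
  have dV := @is_derive_funV _ (fun t => (1 + t) ^+ 2) _ _ q0 dq.
  by derive_continuous.
move=> y; rewrite /= in_itv/= => xy1; rewrite lee_fin u_integrandE// normrM.
have /andP[w0 w1] := weight_bounds a0 xy1.
have ww : 0 <= y / (1 + y) ^+ 2.
  by apply: le_trans w0; rewrite divr_ge0// ltW.
rewrite (ger0_norm ww) ler_piMr//; apply: le_trans w1 _.
by rewrite invf_le1// ler1n.
Qed.

Let Rintegral_u_bounds a : 0 < a ->
  x0 a / 4 * (pi ^+ 2 / 12 / a) <= \int[mu]_(y in `[x0 a, 1]) u_integrand a y <=
  4^-1 * (pi ^+ 2 / 12 / a).
Proof.
move=> a0; have [Hi HE] := integrable_log_density a0.
have ui := integrable_u_integrand a0.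
rewrite -HE -!RintegralZl//; apply/andP; split; apply: le_Rintegral => //.
- exact: (integrableZl _ _ Hi).
- move=> y; rewrite /= in_itv/= => xy1; rewrite u_integrandE// [leRHS]mulrC.
  have /andP[w0 w1] := weight_bounds a0 xy1.
  by rewrite ler_wpM2r// log_density_ge0.
- exact: (integrableZl _ _ Hi).
- move=> y; rewrite /= in_itv/= => xy1; rewrite u_integrandE// [leLHS]mulrC.
  have /andP[w0 w1] := weight_bounds a0 xy1.
  by rewrite ler_wpM2r// log_density_ge0.
Qed.

Let u_integrand_ge0 a y : 0 < a -> x0 a <= y <= 1 -> 0 <= u_integrand a y.
Proof.
move=> a0 xy1; rewrite u_integrandE// mulr_ge0 ?log_density_ge0//.
have /andP[w0 _] := weight_bounds a0 xy1.
by apply: le_trans w0; rewrite divr_ge0// ltW.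
Qed.

(** The factor x + 1 is at most 2, and the integrand is nonnegative, so the tail is at most the full
    integral. *)
Let u_values_le a m : 0 < a -> u_values a m ->
  m <= 2 * \int[mu]_(y in `[x0 a, 1]) u_integrand a y.
Proof.
move=> a0 [x]; rewrite /u_domain/= in_itv/= => /andP[xx x1] <-.
rewrite /u_objective (@Rintegral_itvcc_tail _ (x0 a)) ?xx//; last first.
  exact: integrable_u_integrand.
have I0 : 0 <= \int[mu]_(y in `[x0 a, x]) u_integrand a y.
  apply: Rintegral_ge0 => y; rewrite /= in_itv/= => /andP[xy yx].
  by apply: u_integrand_ge0 => //; rewrite xy (le_trans yx).
have J0 : 0 <= \int[mu]_(y in `[x, 1]) u_integrand a y.
  apply: Rintegral_ge0 => y; rewrite /= in_itv/= => /andP[xy yx].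
  by apply: u_integrand_ge0 => //; rewrite yx (le_trans xx).
rewrite (@Rintegral_itvcc_tail _ (x0 a)) ?xx// in J0; last first.
  exact: integrable_u_integrand.
have x00 : 0 < x by apply: lt_le_trans xx.
move: (\int[_]_(_ in _) _) (\int[_]_(_ in _) _) I0 J0 => p q I0 J0.
by nra.
Qed.

(** The objective is continuous on a compact interval, so it attains a maximum, which is then the
    supremum. *)
Lemma u_is_maximum a : 0 < a -> is_maximum (u_values a) (u a).
Proof.
move=> a0; have ui := integrable_u_integrand a0.
have cu : {within `[x0 a, 1], continuous (u_objective a)}.
  move=> x; apply: cvgM.
    apply: cvgD; last exact: cvg_cst.
    by apply: continuous_subspaceT => t; exact: cvg_id.
  by apply: within_continuous_Rintegral_tail => //; exact/ltW/x0_lt1.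
have [c c01 cmax] := EVT_max (ltW (x0_lt1 a0)) cu.
have Am : u_values a (u_objective a c) by exists c.
have Um : ubound (u_values a) (u_objective a c).
  by move=> _ [x xD <-]; exact: cmax.
suff -> : u a = u_objective a c by split.
apply/eqP; rewrite eq_le; apply/andP; split.
  by apply: ge_sup => //; exists (u_objective a c).
by apply: ub_le_sup => //; exists (u_objective a c).
Qed.

Let u_bounds a : 0 < a ->
  (x0 a + 1) * x0 a / 4 * (pi ^+ 2 / 12) <= a * u a <= pi ^+ 2 / 24.
Proof.
move=> a0; have /andP[lo hi] := Rintegral_u_bounds a0.
have [Au Uu] := u_is_maximum a0.
have uhi := u_values_le a0 Au.
(* The lower bound comes from testing the maximum at the left end of the domain. *)
have ulo : u_objective a (x0 a) <= u a.
  by apply: Uu; exists (x0 a) => //; rewrite /u_domain/= in_itv/= lexx/= ltW// x0_lt1.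
have x00 := x0_gt0 a.
have zE : pi ^+ 2 / 24 = pi ^+ 2 / 12 / 2 :> R by field.
rewrite zE; move: lo hi uhi ulo; rewrite /u_objective.
move: (\int[_]_(_ in _) _) (pi ^+ 2 / 12) => J z lo hi uhi ulo.
apply/andP; split.
  apply: le_trans (_ : a * ((x0 a + 1) * J) <= _); last by rewrite ler_pM2l.
  have -> : (x0 a + 1) * x0 a / 4 * z = a * ((x0 a + 1) * (x0 a / 4 * (z / a))).
    by field; rewrite gt_eqF.
  by rewrite ler_pM2l// ler_wpM2l// addr_ge0// ltW.
apply: le_trans (_ : a * (2 * J) <= _); first by rewrite ler_pM2l.
have -> : z / 2 = a * (2 * (4^-1 * (z / a))) by field; rewrite gt_eqF.
by rewrite ler_pM2l// ler_pM2l.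
Qed.

(** Squeezed by 1 - (ln 2) / a <= exp(-(ln 2) / a) < 1. *)
Let cvg_x0 : x0 a @[a --> +oo] --> (1 : R).
Proof.
apply: (@squeeze_cvgr _ _ _ _ (fun a => 1 - ln 2 * a `^ (- 1)) (fun=> 1)).
- near=> a.
  have a0 : 0 < a by near: a; apply: nbhs_pinfty_gt; rewrite num_real.
  rewrite (ltW (x0_lt1 a0)) andbT powR_inv1; last exact: ltW.
  rewrite /x0 /powR gt_eqF//; apply: le_trans (expR_ge1Dx _).
  by rewrite mulNr [ln 2 * _]mulrC.
- rewrite [X in _ --> X](_ : _ = 1 - ln 2 * 0); last by rewrite mulr0 subr0.
  apply: cvgB; first exact: cvg_cst.
  by apply: cvgM; [exact: cvg_cst|exact: cvgy_powRN].
- exact: cvg_cst.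
Unshelve. all: by end_near. Qed.

Lemma cvg_u : a * u a @[a --> +oo] --> (pi ^+ 2 / 24 : R).
Proof.
apply: (@squeeze_cvgr _ _ _ _ (fun a => (x0 a + 1) * x0 a / 4 * (pi ^+ 2 / 12))
  (fun=> pi ^+ 2 / 24)).
- near=> a; apply: u_bounds.
  by near: a; apply: nbhs_pinfty_gt; rewrite num_real.
- rewrite [X in _ --> X](_ : _ = (1 + 1) * 1 / 4 * (pi ^+ 2 / 12)); last by field.
  apply: cvgM; last exact: cvg_cst.
  apply: cvgM; last exact: cvg_cst.
  apply: cvgM; last exact: cvg_x0.
  by apply: cvgD; [exact: cvg_x0|exact: cvg_cst].
- exact: cvg_cst.
Unshelve. all: by end_near. Qed.

Lemma integrable_u_domain a : 0 < a ->
  mu.-integrable (u_domain a) (EFin \o u_integrand a).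
Proof. exact: integrable_u_integrand. Qed.

End maximum.

Theorem propositionA5 (R : realType) :
  ((forall alpha : R, 0 < alpha ->
      (@lebesgue_measure R).-integrable (u_domain alpha)
        (EFin \o u_integrand alpha) /\
      is_maximum (u_values alpha) (u alpha)) /\
   (alpha * u alpha @[alpha --> +oo] --> (pi ^+ 2 / 24 : R))) /\
  ((forall alpha : R, 1 < alpha ->
      (@lebesgue_measure R).-integrable `[1, +oo[
        (EFin \o v_integrand alpha)) /\
   (alpha * v alpha @[alpha --> +oo] --> (pi ^+ 2 / 6 : R))).
Proof.
split; split.
- by move=> a a0; split; [exact: integrable_u_domain|exact: u_is_maximum].
- exact: cvg_u.
- by move=> a; exact: integrable_v_integrand.
- exact: cvg_v.
Qed.
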